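(* Let $q\ge p\ge 3$ be coprime integers and let $$Q_{\{p,q\}}(x)=\frac{(1-x^{pq})(1-x)}{(1-x^p)(1-x^q)},$$ which is a polynomial of degree $(p-1)(q-1)$. Define $r_0=p$, $r_1=\langle q\rangle_p$, and for $1\le i\le t$ define integers $Z_i$, $r_{i+1}$ by $r_{i-1}=Z_ir_i+r_{i+1}$, $0\le r_{i+1}<r_i$, where $t$ is the index with $r_t=1$ (so $r_{t+1}=0$ and $Z_t=r_{t-1}$). Put $$G_i=\{\,r_{i-1}-zr_i-1 : 0\le z\le Z_i-1\,\}\quad (1\le i\le t-1),$$ $$G_t=\{\,r_{t-1}-zr_t-1 : 0\le z\le Z_t-2\,\}=\{1,2,\dots,r_{t-1}-1\}.$$ Then the gapset of $Q_{\{p,q\}}$ satisfies $$G(Q_{\{p,q\}})=\bigcup_{i=1}^t G_i,$$ and $$\#G(Q_{\{p,q\}})=\sum_{i=1}^t\lfloor r_{i-1}/r_i\rfloor-1.$$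
   Context: $\langle x\rangle_p$ denotes the least nonnegative residue of $x$ modulo $p$. For a polynomial $f$ with at least two nonzero coefficients, written as $f(x)=c_1x^{e_1}+\dots+c_kx^{e_k}$ with all $c_i\ne0$ and $0\le e_1<e_2<\dots<e_k$, its gapset is $G(f)=\{e_{i+1}-e_i : 1\le i\le k-1\}$. Note $Z_i=\lfloor r_{i-1}/r_i\rfloor$. *)

(* Defs.v *)
From HB Require Import structures.
From mathcomp Require Export all_boot all_order all_algebra.
From mathcomp Require Export finmap.

Set Implicit Arguments.
Unset Strict Implicit.
Unset Printing Implicit Defensive.

Import GRing.Theory.
Local Open Scope ring_scope.

Definition Qnum (p q : nat) : {poly rat} := (1 - 'X^(p * q)) * (1 - 'X).

Definition Qden (p q : nat) : {poly rat} := (1 - 'X^p) * (1 - 'X^q).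

(* Euclidean quotient in rat['X]; it is the fraction only when Qden p q divides
   Qnum p q. *)
Definition Qpoly (p q : nat) : {poly rat} := Qnum p q %/ Qden p q.

(* Increasing list e_1 < ... < e_k of the exponents that occur in f. *)
Definition exponents (R : nzRingType) (f : {poly R}) : seq nat :=
  [seq e <- iota 0 (size f) | f`_e != 0].

(* Meant for polynomials with at least two nonzero coefficients; fset0
   otherwise. *)
Definition gapset (R : nzRingType) (f : {poly R}) : {fset nat} :=
  let e := exponents f in
  [fset (nth 0 e i.+1 - nth 0 e i)%N | i in iota 0 (size e).-1]%fset.

(* The set G_i, where t is the last index, whose range of z is shorter by one.
   In the intended use z * r i < r i.-1, so the subtractions do not truncate. *)
Definition Gset (r Z : nat -> nat) (t i : nat) : {fset nat} :=
  [fset (r i.-1 - z * r i - 1)%N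
     | z in iota 0 (if i == t then (Z i).-1 else Z i)]%fset.

(* Main.v *)
(* Let S be the numerical semigroup generated by p and q. Then Q(x) is
   (1 - x) times the generating series of S, so its exponents are the integers
   where membership in S changes, and the gaps between them are the lengths of
   the runs of S and of its complement below (p-1)(q-1). The symmetry
   n -> (p-1)(q-1) - 1 - n of S exchanges the two kinds of runs; hence
   the gapset consists of the numbers d - 1 > 0 with d the distance between two
   consecutive elements of S.
   Consider the lattice of integer points (e, y) with e = y q mod p. If
   (u, A), (v, -B) is a basis of it with u, v, A, B > 0, then u + v is
   the only such distance d with max(u, v) < d <= u + v. The Euclidean algorithm
   yields such bases with {u, v} = {r_i, r_(i-1) - (z+1) r_i} for which
   u + v = r_(i-1) - z r_i, and the corresponding intervals cover [2, p]. *)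
Require Import Defs.
From mathcomp Require Import zify ring.
Set Implicit Arguments.
Unset Strict Implicit.
Unset Printing Implicit Defensive.
Import Order.TTheory GRing.Theory Num.Theory.
Local Open Scope ring_scope.

(** * The semigroup generated by p and q *)

(** Bounding [b] by [p] makes membership decidable and loses nothing: [p] copies of [q] can be
    traded for [q] copies of [p]. *)
Definition in_semigroup (p q n : nat) : bool :=
  [exists b : 'I_p, (b * q <= n)%N && (p %| n - b * q)%N].

Definition consecutive (P : pred nat) (s d : nat) : Prop :=
  [/\ P s, P (s + d)%N & forall e, (0 < e < d)%N -> ~~ P (s + e)%N].

Lemma in_semigroupP (p q n : nat) : (0 < p)%N ->
  reflect (exists a b : nat, n = (a * p + b * q)%N) (in_semigroup p q n).
Proof.
move=> p0; apply: (iffP existsP) => [[b /andP[le_bq /dvdnP[a def_a]]]|[a [b ->]]].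
  by exists a, b; rewrite -def_a subnK.
exists (Ordinal (ltn_pmod b p0)) => /=.
have -> : (a * p + b * q = (a + b %/ p * q) * p + b %% p * q)%N.
  by rewrite {1}(divn_eq b p); move: (b %/ p)%N (b %% p)%N => x y; lia.
by rewrite leq_addl addnK dvdn_mull.
Qed.

(** [b] is [n] times the inverse of [q] modulo [p]. The integer [k] may be negative; [n] lies in the
    semigroup as soon as [k >= 0]. *)
Lemma in_semigroup_residue (p q n : nat) : (0 < p)%N -> coprime p q ->
  exists2 b : nat, (b < p)%N & exists k : int, n%:Z = b%:Z * q%:Z + k * p%:Z.
Proof.
move=> p0 cpq.
have [u def_u] : exists u : nat, (u * q = 1 %[mod p])%N.
  have [q0|q0] := posnP q.
    by exists 0%N; move: cpq; rewrite q0 /coprime gcdn0 => /eqP ->; rewrite !modn1.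
  case: (egcdnP p q0) => u v def_u _; exists u.
  by rewrite def_u gcdnC (eqP cpq) modnMDl.
have /eqP : (n * u * q = n %[mod p])%N by rewrite -mulnA -modnMmr def_u modnMmr muln1.
move=> /eqP E; exists (n * u %% p)%N; first by rewrite ltn_pmod.
have := E; have := divn_eq n p; have := divn_eq (n * u * q) p.
have := divn_eq (n * u)%N p.
set x := (n * u %% p)%N; set y := (n * u %/ p)%N => Enu.
set w := (n * u * q %/ p)%N => Enuq En Em.
exists ((n %/ p)%N%:Z - w%:Z + y%:Z * q%:Z).
have : (n * u * q = y * p * q + x * q)%N by rewrite Enu mulnDl.
rewrite Enuq Em => F; clearbody x y w; clear - En F.
by move: (n %% p)%N (n %/ p)%N En F => c d; nia.
Qed.

(** A negative [k] in [n = b q + k p] with [b <= p - 1] would force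
    [n <= (p - 1) q - p < (p - 1) (q - 1)]. *)
Lemma in_semigroup_conductor (p q n : nat) : (0 < p)%N -> coprime p q ->
  ((p - 1) * (q - 1) <= n)%N -> in_semigroup p q n.
Proof.
move=> p0 cpq le_n; have [b ltbp [k def_n]] := in_semigroup_residue n p0 cpq.
apply/in_semigroupP => //; exists `|k|%N, b.
have : (0 <= k)%R by nia.
by lia.
Qed.

(** If [n = b q + k p] is a non-member, then [k < 0] and its reflection is
    [(p - 1 - b) q + (- k - 1) p]. If both were members, [p q] would be a combination of [p] and [q]
    with positive coefficients, that of [q] divisible by [p], which is too large. *)
Lemma in_semigroup_sym (p q n : nat) : (0 < p)%N -> (0 < q)%N -> coprime p q ->
  (n < (p - 1) * (q - 1))%N ->
  in_semigroup p q ((p - 1) * (q - 1) - 1 - n) = ~~ in_semigroup p q n.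
Proof.
move=> p0 q0 cpq lt_n; apply/idP/idP; last first.
  move=> nSn; have [b ltbp [k def_n]] := in_semigroup_residue n p0 cpq.
  have k_lt0 : (k < 0)%R.
    case: ltrP => // k0; case/negP: nSn; apply/in_semigroupP => //.
    by exists `|k|%N, b; lia.
  apply/in_semigroupP => //; exists (`|k| - 1)%N, (p - 1 - b)%N.
  have En : (n + (`|k| - 1).+1 * p = b * q)%N by nia.
  have Ep : p = (b + (p - 1 - b)).+1 by lia.
  case: q q0 lt_n En {cpq def_n nSn} => // q _.
  move: (p - 1 - b)%N (`|k| - 1)%N Ep => c K Ep.
  by rewrite !subn1 /= {1 2 3}Ep /=; lia.
move=> /in_semigroupP-/(_ p0)[a [b E]]; apply/negP.
move=> /in_semigroupP-/(_ p0)[a' [b' E']].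
have F : ((a + a' + 1) * p + (b + b' + 1) * q = q * p)%N.
  case: p p0 lt_n E E' {cpq} => // p _; case: q q0 => // q _.
  by rewrite !subn1 /=; lia.
have : (p %| (b + b' + 1) * q)%N.
  by rewrite -(dvdn_addr _ (dvdn_mull (a + a' + 1) (dvdnn p))) F dvdn_mull.
rewrite Gauss_dvdl // => /dvdn_leq; rewrite addn1 => /(_ isT) le_p.
have : (p * q <= (b + b').+1 * q)%N by rewrite leq_mul2r le_p orbT.
by rewrite -[(b + b').+1]addn1; lia.
Qed.

(** * The lattice of points (e, y) with e = y q mod p *)

(* The integer points (e, y) with e = y q mod p form a lattice of determinant
   p, with basis (u, A), (v, - B). *)
Record lattice_basis (p q u v A B : nat) : Prop := LatticeBasis {
  basis_u : (0 < u)%N;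
  basis_v : (0 < v)%N;
  basis_A : (0 < A)%N;
  basis_B : (0 < B)%N;
  basis_det : (u * B + v * A = p)%N;
  basis_uA : exists k : int, u%:Z = A%:Z * q%:Z + k * p%:Z;
  basis_vB : exists k : int, v%:Z = - (B%:Z * q%:Z) + k * p%:Z }.

(** Write [(e, y) = m (u, A) + n (v, - B)]. If [m, n >= 1] then [e >= u + v]; if [m, n <= 0] then
    [e <= 0]; mixed signs give [y >= A] or [y <= - B]. *)
Lemma lattice_basis_box (p q u v A B e : nat) (y k : int) :
  lattice_basis p q u v A B -> (0 < e < u + v)%N ->
  e%:Z = y * q%:Z + k * p%:Z -> - B%:Z < y < A%:Z -> False.
Proof.
case=> u0 v0 A0 B0 det [k1 E1] [k2 E2] /andP[e0 e_lt] Ee /andP[yB yA].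
have p0 : (0 < p)%N by nia.
(* Cramer's rule, with the division by the determinant [p] already carried out. *)
pose m : int := k * B%:Z + y * k2; pose n : int := k * A%:Z - y * k1.
have Em : m * p%:Z = e%:Z * B%:Z + y * v%:Z by rewrite Ee E2 /m; ring.
have En : n * p%:Z = e%:Z * A%:Z - y * u%:Z by rewrite Ee E1 /n; ring.
have Ed : p%:Z = u%:Z * B%:Z + v%:Z * A%:Z by lia.
have e_mn : e%:Z = m * u%:Z + n * v%:Z.
  apply: (@mulIf _ p%:Z); first by lia.
  by rewrite mulrDl [m * _ * _]mulrAC [n * _ * _]mulrAC Em En {1}Ed; ring.
have y_mn : y = m * A%:Z - n * B%:Z.
  apply: (@mulIf _ p%:Z); first by lia.
  by rewrite mulrBl [m * _ * _]mulrAC [n * _ * _]mulrAC Em En {1}Ed; ring.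
clear Em En Ee E1 E2 Ed; clearbody m n.
have [m0|m0] := lerP m 0; have [n0|n0] := lerP n 0; nia.
Qed.

Lemma lattice_basis_leq (p q u v A B : nat) :
  lattice_basis p q u v A B -> (u + v <= p)%N.
Proof.
by case=> u0 v0 A0 B0 <- _ _; rewrite leq_add // leq_pmulr.
Qed.

Lemma lattice_basis_gt0 (p q u v A B : nat) :
  lattice_basis p q u v A B -> (0 < p)%N.
Proof. by case=> u0 v0 A0 B0 <- _ _; rewrite addn_gt0 muln_gt0 u0 B0. Qed.

(** The pair is a multiple of [p] followed by [(A - B) q] if [A > B], and [(B - A) q] followed by a
    multiple of [p] otherwise. A member strictly between would give a lattice point in the forbidden
    box. *)
Lemma lattice_basis_consecutive (p q u v A B : nat) :
  (p <= q)%N -> lattice_basis p q u v A B ->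
  exists s, consecutive (in_semigroup p q) s (u + v).
Proof.
move=> le_pq bas; have uvp := lattice_basis_leq bas.
have p0 := lattice_basis_gt0 bas; have pZ0 : 0 < p%:Z by [].
case: (bas) => u0 v0 A0 B0 _ [k1 E1] [k2 E2].
have [k Ek] : exists k : int,
    (u + v)%N%:Z = (A%:Z - B%:Z) * q%:Z + k * p%:Z.
  by exists (k1 + k2); lia.
have [ltBA|leAB] := ltnP B A.
  have [D0 def_A] : (0 < A - B)%N /\ A = (B + (A - B))%N by lia.
  move: (A - B)%N D0 def_A => D D0 def_A.
  have Euv : (u + v)%N%:Z = D%:Z * q%:Z + k * p%:Z by lia.
  have le_uv : (u + v <= D * q)%N.
    by rewrite (leq_trans uvp) // (leq_trans le_pq) // leq_pmull.
  exists (D * q - (u + v))%N; split.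
  - apply/in_semigroupP => //; exists (absz k), 0%N.
    have k_le0 : k <= 0 by rewrite -(pmulr_lle0 _ pZ0); lia.
    have def_k : k = - (absz k)%:Z by lia.
    by move: (absz k) def_k => K def_k; rewrite def_k in Euv; lia.
  - by apply/in_semigroupP => //; exists 0%N, D; lia.
  move=> e /andP[e0 e_lt]; apply/negP => /in_semigroupP-/(_ p0)[a [b Ee]].
  have bD : (b < D)%N.
    rewrite ltnNge; apply/negP => leDb.
    by have := leq_mul leDb (leqnn q); lia.
  by apply: (lattice_basis_box (e := e) (y := b%:Z) (k := a%:Z + k) bas); lia.
have def_B : B = (A + (B - A))%N by lia.
move: (B - A)%N def_B => D def_B.
have Euv : (u + v)%N%:Z + D%:Z * q%:Z = k * p%:Z by lia.
exists (D * q)%N; split.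
- by apply/in_semigroupP => //; exists 0%N, D; lia.
- apply/in_semigroupP => //; exists (absz k), 0%N.
  have k_ge0 : 0 <= k by rewrite -(pmulr_lge0 _ pZ0); lia.
  have def_k : k = (absz k)%:Z by lia.
  by move: (absz k) def_k => K def_k; rewrite def_k in Euv; lia.
move=> e /andP[e0 e_lt]; apply/negP => /in_semigroupP-/(_ p0)[a [b Ee]].
have bD : (b <= D)%N.
  rewrite leqNgt; apply/negP => ltDb.
  by have := leq_mul ltDb (leqnn q); lia.
by apply: (lattice_basis_box (e := e) (y := b%:Z - D%:Z) (k := a%:Z) bas); lia.
Qed.

(** If [d < u + v], the box forces [b' - b >= A] or [b' - b <= - B]. Then [s + u], respectively
    [s + v], is a member strictly between [s] and [s + d]. *)
Lemma lattice_basis_distance (p q u v A B s d : nat) :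
  (p <= q)%N -> lattice_basis p q u v A B ->
  (maxn u v < d <= u + v)%N -> consecutive (in_semigroup p q) s d ->
  d = (u + v)%N.
Proof.
move=> le_pq bas; rewrite gtn_max -andbA => /and3P[ltud ltvd led].
have uvp := lattice_basis_leq bas.
have p0 := lattice_basis_gt0 bas; have pZ0 : 0 < p%:Z by [].
case: (bas) => u0 v0 A0 B0 _ [k1 E1] [k2 E2].
case=> /in_semigroupP-/(_ p0)[a [b Es]] /in_semigroupP-/(_ p0)[a' [b' Es']] nS.
have mem_S (e : nat) (k y : int) : (s + e)%N%:Z = k * p%:Z + y * q%:Z ->
    0 <= k * p%:Z -> 0 <= y -> in_semigroup p q (s + e).
  rewrite pmulr_lge0 // => Ee k0 y0; apply/in_semigroupP => //.
  exists (absz k), (absz y); move: Ee.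
  by rewrite -{1}[k]gez0_abs // -{1}[y]gez0_abs // => Ee; lia.
apply/eqP; rewrite eqn_leq led leqNgt; apply/negP => lt_d.
have [leAy|ltyA] := leqP (b + A) b'.
  apply: (negP (nS u _)); first by rewrite u0.
  have def_b' : b' = (b + A + (b' - (b + A)))%N by lia.
  move: (b' - (b + A))%N def_b' => f def_b'; rewrite {b' leAy}def_b' in Es'.
  (* The coefficient [a + k1] of [p] in [s + u] must be nonnegative. For [f = 0], [p] would divide
     [d - u], which lies strictly between 0 and [p]; for [f > 0], a spare [q] covers
     [d - u < p <= q]. *)
  have [f0|f0] := posnP f.
    have dvd_p : (p%:Z %| (d - u)%N%:Z)%Z.
      by apply/dvdzP; exists (a'%:Z - a%:Z - k1); rewrite f0 in Es'; lia.
    have /dvdn_leq : (p %| d - u)%N by [].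
    by lia.
  have le_q : (q <= f * q)%N by rewrite leq_pmull.
  by apply: (mem_S u (a%:Z + k1) (b%:Z + A%:Z)); lia.
have [leBy|ltyB] := leqP (b' + B) b.
  apply: (negP (nS v _)); first by rewrite v0.
  by apply: (mem_S v (a%:Z + k2) (b%:Z - B%:Z)); lia.
by apply: (lattice_basis_box (e := d)
  (y := b'%:Z - b%:Z) (k := a'%:Z - a%:Z) bas); lia.
Qed.

(** * Exponents and gaps *)

Lemma consecutive_nthP (e : seq nat) (x : nat) : sorted ltn e ->
  reflect (exists a, [/\ a \in e, (a + x)%N \in e, (0 < x)%N &
             forall c, (a < c < a + x)%N -> c \notin e])
    (x \in [fset (nth 0 e i.+1 - nth 0 e i)%N | i in iota 0 (size e).-1]%fset).
Proof.
move=> e_sorted; have nth_lt : {in [pred n | (n < size e)%N] &,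
    {mono nth 0%N e : i j / (i < j)%N >-> (i < j)%N}}.
  exact: (@lt_sorted_ltn_nth _ nat).
apply: (iffP (imfsetP _ _ _ _)) => /= [[i]|[a [ae axe x0 nbet]]].
  rewrite mem_iota /= => i_lt ->.
  have lti : (i < size e)%N by lia.
  have ltSi : (i.+1 < size e)%N by lia.
  have lt_nth : (nth 0 e i < nth 0 e i.+1)%N by rewrite nth_lt ?inE.
  exists (nth 0%N e i); rewrite subnKC; last exact: ltnW.
  split; rewrite ?mem_nth ?subn_gt0 // => c /andP[lt1 lt2].
  apply/negP => c_in; move: lt1 lt2; rewrite -(nth_index 0%N c_in).
  by rewrite !nth_lt ?inE ?index_mem // => ? ?; lia.
exists (index a e); rewrite ?mem_iota /=; last first.
  pose i := index a e; pose j := index (a + x)%N e.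
  have lti : (i < size e)%N by rewrite index_mem.
  have ltj : (j < size e)%N by rewrite index_mem.
  have Ei : nth 0%N e i = a by exact: nth_index.
  have Ej : nth 0%N e j = (a + x)%N by exact: nth_index.
  have ltij : (i < j)%N by rewrite -nth_lt ?inE // Ei Ej; lia.
  suff -> : (index a e).+1 = j by rewrite Ej Ei; lia.
  apply/eqP; rewrite eqn_leq ltij leqNgt; apply/negP => lt_ij.
  have lt_Si : (i.+1 < size e)%N by lia.
  apply: (negP (nbet (nth 0%N e i.+1) _)); last exact: mem_nth.
  by rewrite -{1}Ei -Ej !nth_lt ?inE //; lia.
have : (index a e < index (a + x) e)%N.
  by rewrite -nth_lt ?inE ?index_mem // !nth_index //; lia.
rewrite ltn_predRL => ltij; apply: leq_ltn_trans ltij _; by rewrite index_mem.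
Qed.

(** * The quotient as [1 - x] times the generating series of the semigroup *)

Definition semigroup_poly (p q : nat) : {poly rat} :=
  \poly_(n < ((p - 1) * (q - 1)).+1)
     ((in_semigroup p q n)%:R - ((0 < n)%N && in_semigroup p q n.-1)%:R).

Lemma in_semigroup0 (p q : nat) : (0 < p)%N -> in_semigroup p q 0.
Proof. by move=> p0; apply/in_semigroupP => //; exists 0%N, 0%N. Qed.

Lemma in_semigroup_frobenius (p q : nat) : (1 < p)%N -> (1 < q)%N ->
  coprime p q -> in_semigroup p q ((p - 1) * (q - 1) - 1) = false.
Proof.
move=> p1 q1 cpq; have := @in_semigroup_sym p q 0.
rewrite subn0 in_semigroup0; last by lia.
by apply; rewrite // ?muln_gt0; lia.
Qed.

Lemma coef_semigroup_poly (p q n : nat) : (0 < p)%N -> coprime p q ->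
  (semigroup_poly p q)`_n =
    (in_semigroup p q n)%:R - ((0 < n)%N && in_semigroup p q n.-1)%:R.
Proof.
move=> p0 cpq; rewrite coef_poly; case: ltnP => // lt_n.
(* Beyond the degree bound [n] and [n - 1] are both members, so the truncation drops only zero
   coefficients. *)
by rewrite (leq_ltn_trans _ lt_n) // !in_semigroup_conductor ?subrr //; lia.
Qed.

Lemma size_semigroup_poly (p q : nat) : (1 < p)%N -> (1 < q)%N ->
  coprime p q -> size (semigroup_poly p q) = ((p - 1) * (q - 1)).+1.
Proof.
move=> p1 q1 cpq; rewrite size_poly_eq //= in_semigroup_conductor //; last by lia.
have := in_semigroup_frobenius p1 q1 cpq; rewrite subn1 => ->.
by rewrite andbF subr0 oner_eq0.
Qed.

Lemma in_semigroup_shift (p q n : nat) : (0 < p)%N -> (p <= n)%N ->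
  in_semigroup p q (n - p) -> in_semigroup p q n.
Proof.
move=> p0 le_pn /in_semigroupP-/(_ p0)[a [b E]]; apply/in_semigroupP => //.
by exists a.+1, b; lia.
Qed.

(** This is the Apery set of the semigroup with respect to [p]. If [b q - p] were a member, [p]
    would divide some [(b - b') q] with [0 < b - b' < p]. *)
Lemma apery_set (p q n : nat) : (0 < p)%N -> coprime p q ->
  in_semigroup p q n && ~~ ((p <= n)%N && in_semigroup p q (n - p))
    = [exists b : 'I_p, n == (b * q)%N].
Proof.
move=> p0 cpq; apply/andP/existsP => [[/existsP[b /andP[leb /dvdnP[k E]]] nS]|].
  exists b; apply/eqP; case: k E => [|k E]; first by lia.
  case/negP: nS; apply/andP; split; first by lia.
  by apply/in_semigroupP => //; exists k, b; lia.
case=> b /eqP->; split.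
  by apply/in_semigroupP => //; exists 0%N, b.
apply/negP => /andP[le_p /in_semigroupP-/(_ p0)[a [b' E]]].
have E' : (a.+1 * p + b' * q = b * q)%N by lia.
have ltb : (b' < b)%N by rewrite ltnNge; apply/negP => leb; nia.
have : (p %| (b - b') * q)%N by rewrite mulnBl -E' addnK dvdn_mull.
rewrite Gauss_dvdl // => /dvdn_leq; have := ltn_ord b; lia.
Qed.

Lemma coef_1subX_mul (R : nzRingType) (f : {poly R}) (k n : nat) :
  ((1 - 'X^k) * f)`_n = f`_n - (if (n < k)%N then 0 else f`_(n - k)).
Proof. by rewrite mulrBl mul1r coefB coefXnM. Qed.

(** Multiplying the generating series by [1 - x^p] leaves the indicator series of the Apery set,
    which is the sum on the right. *)
Lemma semigroup_polyE (p q : nat) : (0 < p)%N -> (0 < q)%N -> coprime p q ->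
  (1 - 'X^p) * semigroup_poly p q = (1 - 'X) * \sum_(b < p) ('X^q) ^+ b.
Proof.
move=> p0 q0 cpq; set g := \sum_(b < p) _.
have coef_g n : g`_n = [exists b : 'I_p, n == (b * q)%N]%:R.
  rewrite /g coef_sum; under eq_bigr do rewrite -exprM coefXn.
  case: existsP => [[b /eqP->]|nb].
    rewrite (bigD1 b) //= mulnC eqxx big1 ?addr0 // => i ne_ib.
    by rewrite eqn_pmul2l // eq_sym -[_ == _]/(i == b) (negPf ne_ib).
  rewrite big1 // => i _; case: eqP => // En; case: nb.
  by exists i; rewrite En mulnC.
apply/polyP => n; rewrite coef_1subX_mul -['X]expr1 coef_1subX_mul.
rewrite !coef_g -!apery_set // !coef_semigroup_poly //.
case: n => [|n] /=.
  by rewrite p0 leqn0 eqn0Ngt p0 /= !subr0 in_semigroup0.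
rewrite subn1 /=.
have S1 := @in_semigroup_shift p q n.+1 p0.
have S0 := @in_semigroup_shift p q n p0.
have [lt_np|le_pn] := ltnP n.+1 p.
  by rewrite (leqNgt p n) (ltnW lt_np) /= !andbT subr0.
have {S1} := S1 le_pn; move: (in_semigroup p q n.+1) => s1.
have [lt_np|{}le_pn] := ltnP n p.
  have -> : p = n.+1 by lia.
  rewrite subnn in_semigroup0 //= => /(_ isT) ->.
  by rewrite andbT /= subr0 addrAC subrr.
have {S0} := S0 le_pn; move: (in_semigroup p q n) => s0.
rewrite subSn //=; move: (in_semigroup p q _) (in_semigroup p q _).
move: s0 s1 => [] [] [] [] //= S0 S1;
  by [ring | have := S0 isT | have := S1 isT].
Qed.

(** A further factor [1 - x^q] telescopes the geometric sum to [1 - x^(p q)]; the division is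
    therefore exact. *)
Lemma QpolyE (p q : nat) : (0 < p)%N -> (0 < q)%N -> coprime p q ->
  Qpoly p q = semigroup_poly p q /\ Qpoly p q * Qden p q = Qnum p q.
Proof.
move=> p0 q0 cpq.
have fracE : semigroup_poly p q * Qden p q = Qnum p q.
  rewrite /Qden /Qnum mulrA [_ * (1 - 'X^p)]mulrC semigroup_polyE //.
  rewrite mulnC exprM -[1 - _ ^+ p]opprB subrX1; ring.
have Xn_neq1 k : (0 < k)%N -> 1 - 'X^k != 0 :> {poly rat}.
  by move=> k0; rewrite -opprB oppr_eq0 monic_neq0 ?monicXnsubC.
have den0 : Qden p q != 0 by rewrite mulf_neq0 ?Xn_neq1.
have E : Qpoly p q = semigroup_poly p q by rewrite /Qpoly -fracE mulpK.
by rewrite E.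
Qed.

(** * From gaps between exponents to consecutive semigroup elements *)

Lemma mem_exponents (p q n : nat) : (1 < p)%N -> (1 < q)%N -> coprime p q ->
  (n \in exponents (semigroup_poly p q)) =
    (n <= (p - 1) * (q - 1))%N &&
      (in_semigroup p q n != ((0 < n)%N && in_semigroup p q n.-1)).
Proof.
move=> p1 q1 cpq; have p0 := ltnW p1.
rewrite mem_filter mem_iota size_semigroup_poly // coef_semigroup_poly //.
rewrite andbC; congr (_ && _); rewrite ?ltnS // subr_eq0.
by case: (in_semigroup p q n) (_ && _) => [] [].
Qed.

Lemma gapset_semigroup (p q l : nat) : (1 < p)%N -> (1 < q)%N -> coprime p q ->
  l \in gapset (semigroup_poly p q) <->
  (0 < l)%N /\ exists s, consecutive (in_semigroup p q) s l.+1.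
Proof.
move=> p1 q1 cpq; have p0 := ltnW p1; have q0 := ltnW q1.
have e_sorted : sorted ltn (exponents (semigroup_poly p q)).
  by rewrite sorted_filter ?iota_ltn_sorted //; apply: ltn_trans.
have memE := mem_exponents _ p1 q1 cpq.
have cond n := in_semigroup_conductor (n := n) p0 cpq.
have sym n := in_semigroup_sym (n := n) p0 q0 cpq.
pose c := ((p - 1) * (q - 1))%N; rewrite -/c in memE cond sym.
split=> [/(consecutive_nthP _ e_sorted)[a]|[l0 [s [Ss Ssl nS]]]]; last first.
  have nSl : in_semigroup p q (s + l) = false by apply/negbTE/nS; lia.
  have lt_c : (s + l < c)%N by rewrite ltnNge; apply/negP => /cond; rewrite nSl.
  apply/(consecutive_nthP _ e_sorted); exists s.+1; rewrite !memE.
  split=> //.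
  - rewrite /= Ss -addn1 (negPf (nS 1%N _)) //; lia.
  - by rewrite addSn -addnS Ssl addnS /= nSl; lia.
  move=> m lt_m; rewrite memE (_ : m = s + (m - s))%N; last by lia.
  rewrite (negPf (nS (m - s)%N _)); last by lia.
  rewrite (_ : (s + (m - s)).-1 = s + (m - s - 1))%N; last by lia.
  by rewrite (negPf (nS (m - s - 1)%N _)) ?andbF //; lia.
rewrite !memE => -[/andP[le_a cha] /andP[le_al chal] l0 nch]; split=> //.
(* Membership changes only at exponents, so it is constant from [a] to [a + l - 1]. *)
have const e : (e < l)%N -> in_semigroup p q (a + e) = in_semigroup p q a.
  elim: e => [|e IHe] lt_e; first by rewrite addn0.
  have := nch (a + e.+1)%N; rewrite memE addnS /= -IHe; last by lia.
  by rewrite negb_and negbK => /(_ _)/orP[||/eqP]; lia.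
have chl : in_semigroup p q (a + l) = ~~ in_semigroup p q a.
  move: chal; rewrite addn_gt0 l0 orbT -(const l.-1); last by lia.
  by rewrite (_ : (a + l).-1 = a + l.-1)%N; [do 2!case: in_semigroup | lia].
case Sa: (in_semigroup p q a) chl cha => /= Sal.
  (* A run of S: reflect it to a run of the complement. *)
  have lt_c : (a + l < c)%N by rewrite ltnNge; apply/negP => /cond; rewrite Sal.
  move=> nSa; exists (c - 1 - (a + l))%N; split; first by rewrite sym ?Sal.
    (* For [a = 0] the right end is [c], a member by the conductor bound instead of the symmetry. *)
    case: a {const nch le_a le_al chal Sa Sal} nSa lt_c => [|a] /= nSa lt_c.
      by apply: cond; lia.
    rewrite (_ : _ + _ = c - 1 - a)%N ?sym; lia.
  move=> e /andP[e0 lt_e].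
  rewrite (_ : _ + _ = c - 1 - (a + (l - e)))%N; last by lia.
  by rewrite sym ?const ?Sa //; lia.
(* A run of the complement: its neighbours [a - 1] and [a + l] are the consecutive members. *)
case: (posnP a) => [a0|a0]; first by rewrite a0 in_semigroup0 in Sa.
move=> /= Sa1; exists a.-1; split.
- by move: Sa1; case: in_semigroup.
- by rewrite addnS -addSn prednK.
move=> e lt_e; rewrite (_ : _ + _ = a + e.-1)%N; last by lia.
by rewrite const ?Sa //; lia.
Qed.

(** * Euclid's algorithm *)

Record euclid (p q t : nat) (r Z : nat -> nat) : Prop := Euclid {
  euclid_p : (1 < p)%N;
  euclid_r0 : r 0%N = p;
  euclid_r1 : r 1%N = (q %% p)%N;
  euclid_div : forall i, (1 <= i <= t)%N ->
    r i.-1 = (Z i * r i + r i.+1)%N /\ (r i.+1 < r i)%N;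
  euclid_rt : r t = 1%N }.

Definition Gsize (Z : nat -> nat) (t i : nat) : nat :=
  if i == t then (Z i).-1 else Z i.

Section Euclid.
Context (p q t : nat) (r Z : nat -> nat) (eucl : euclid p q t r Z).

Lemma euclid_t : (0 < t)%N.
Proof.
case: t eucl => // -[p1 r0 _ _ rt]; rewrite r0 in rt.
by rewrite rt in p1.
Qed.

Lemma euclid_lt i : (0 < i <= t)%N -> (r i < r i.-1)%N.
Proof.
case: eucl => p1 r0 r1 rdiv rt; case: i => [//|[|i]] lei /=.
  by rewrite r0 r1 ltn_mod ltnW.
by have [|] := rdiv i.+1; first by lia.
Qed.

Lemma euclid_gt0 i : (i <= t)%N -> (0 < r i)%N.
Proof.
rewrite leq_eqVlt => /predU1P[->|lt_i]; first by rewrite (euclid_rt eucl).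
by apply: leq_ltn_trans (euclid_lt (i := i.+1) _).
Qed.

Lemma euclid_antitone i j : (i <= j <= t)%N -> (r j <= r i)%N.
Proof.
case/andP; elim: j => [|j IHj]; first by rewrite leqn0 => /eqP->.
rewrite leq_eqVlt => /predU1P[->//|lt_ij] lt_j.
by rewrite (leq_trans (ltnW (euclid_lt (i := j.+1) _))) //= IHj // ltnW.
Qed.

Lemma euclid_end : r t.+1 = 0%N /\ Z t = r t.-1.
Proof.
have [|Et] := euclid_div eucl (i := t); first by rewrite euclid_t leqnn.
by rewrite Et (euclid_rt eucl) muln1 ltnS leqn0 => /eqP->; rewrite addn0.
Qed.

(** The shorter range at [t] reflects [r_(t+1) = 0]: for every [i] the admissible [z] are those with
    [r_(i-1) - (z+1) r_i > 0], as a lattice basis requires. *)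
Lemma ltn_Gsize i z : (0 < i <= t)%N ->
  (z < Gsize Z t i)%N = (r i + z * r i < r i.-1)%N.
Proof.
move=> le_i; have [E lt_r] := euclid_div eucl le_i.
rewrite /Gsize -mulSn E; case: eqP => [->|/eqP ne_i].
  by rewrite (euclid_rt eucl) euclid_end.1; lia.
have r2 : (0 < r i.+1)%N by apply: euclid_gt0; lia.
apply/idP/idP => [lt_z|]; first by have := leq_mul lt_z (leqnn (r i)); lia.
apply: contraTltn => le_Z; rewrite -leqNgt.
have := leq_mul le_Z (leqnn (r i)); lia.
Qed.

Lemma mem_Gset i l : (0 < i <= t)%N ->
  reflect (exists2 z, (r i + z * r i < r i.-1)%N & l.+1 = (r i.-1 - z * r i)%N)
          (l \in Gset r Z t i).
Proof.
move=> le_i; have r_gt0 : (0 < r i)%N by apply: euclid_gt0; lia.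
apply: (iffP (imfsetP _ _ _ _)) => /= [[z]|[z lt_z E]].
  rewrite mem_iota add0n -[if _ then _ else _]/(Gsize Z t i) ltn_Gsize //.
  by move=> lt_z ->; exists z; lia.
exists z; last by lia.
by rewrite mem_iota add0n -[if _ then _ else _]/(Gsize Z t i) ltn_Gsize.
Qed.

Lemma Gset_bounds i l : (0 < i <= t)%N ->
  l \in Gset r Z t i -> (r i <= l < r i.-1)%N.
Proof. by move=> le_i /(mem_Gset _ le_i)[z]; lia. Qed.

Lemma card_Gset i : (0 < i <= t)%N -> #|` Gset r Z t i|%fset = Gsize Z t i.
Proof.
move=> le_i; rewrite card_in_imfset /=.
  by rewrite undup_id ?iota_uniq // size_iota.
move=> z z'; rewrite /= !mem_iota !add0n.
rewrite -[if _ then _ else _]/(Gsize Z t i) !ltn_Gsize // => lt_z lt_z' E.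
have r_gt0 : (0 < r i)%N by apply: euclid_gt0; lia.
by apply/eqP; rewrite -(eqn_pmul2r r_gt0); apply/eqP; lia.
Qed.

(* Consecutive convergents: r_(i-1) and r_i have coordinates of opposite sign
   in the lattice of integer points (e, y) with e = y q mod p. *)
Lemma euclid_convergents i : (0 < i <= t)%N ->
  exists sg : int, exists A A' : nat,
    [/\ sg = 1 \/ sg = -1, (0 < A)%N, (r i * A' + r i.-1 * A)%N = p,
        exists k : int, (r i)%:Z = sg * A%:Z * q%:Z + k * p%:Z &
        exists k : int, (r i.-1)%:Z = - sg * A'%:Z * q%:Z + k * p%:Z].
Proof.
case: eucl => p1 r0 r1 rdiv _; elim: i => // -[_ _|i IHi lt_i].
  exists 1, 1%N, 0%N; rewrite r0 r1; split; [by left | by [] | by lia | |].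
    by exists (- (q %/ p)%N%:Z); have := divn_eq q p; lia.
  by exists 1; lia.
have le_i : (0 < i.+1 <= t)%N by lia.
have [E _] := rdiv _ le_i.
have {IHi} [sg [A [A' [sgE A0 det [k1 E1] [k2 E2]]]]] := IHi le_i.
(* One step of the continuant recurrence; the sign alternates. *)
exists (- sg), (A' + Z i.+1 * A)%N, A; split => /=.
- by case: sgE => ->; [right | left]; rewrite ?opprK.
- have lt_r := euclid_lt le_i; rewrite /= in lt_r.
  case: (Z i.+1) E => [|n] /= E; last by lia.
  by have := rdiv _ le_i; rewrite /= E; lia.
- by rewrite -det E; lia.
- exists (k2 - (Z i.+1)%:Z * k1).
  have -> : (r i.+2)%:Z = (r i)%:Z - (Z i.+1)%:Z * (r i.+1)%:Z by rewrite E /=; lia.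
  by rewrite /= in E2; rewrite E2 E1; ring.
- by exists k1; rewrite opprK.
Qed.
(** Subtracting [z + 1] times the vector of [r_i] from that of [r_(i-1)] preserves the determinant
    and the opposite signs; [sg] decides which vector comes first. *)
Lemma euclid_lattice i z : (0 < i <= t)%N -> (r i + z * r i < r i.-1)%N ->
  exists u v A B, [/\ lattice_basis p q u v A B,
    maxn u v = maxn (r i) (r i.-1 - z.+1 * r i) &
    (u + v = r i.-1 - z * r i)%N].
Proof.
move=> le_i lt_z; have r_gt0 : (0 < r i)%N by apply: euclid_gt0; lia.
have [sg [A [A' [sgE A0 det [k1 E1] [k2 E2]]]]] := euclid_convergents le_i.
pose v := (r i.-1 - z.+1 * r i)%N; pose B := (A' + z.+1 * A)%N.
have Ev : (v%:Z = (r i.-1)%:Z - z.+1%:Z * (r i)%:Z) by rewrite /v; lia.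
have v_gt0 : (0 < v)%N by rewrite /v; lia.
have B_gt0 : (0 < B)%N by rewrite addn_gt0 muln_gt0 A0 orbT.
have detB : (r i * B + v * A = p)%N.
  have Er : r i.-1 = (v + z.+1 * r i)%N by rewrite /v; lia.
  by move: det; rewrite Er /B; lia.
have EvB : exists k : int, v%:Z = - sg * B%:Z * q%:Z + k * p%:Z.
  exists (k2 - z.+1%:Z * k1); rewrite Ev E1 E2 /B PoszD PoszM; ring.
case: EvB => k3 E3.
have Esum : (r i + v = r i.-1 - z * r i)%N by rewrite /v mulSn; lia.
case: sgE => sgE; rewrite sgE in E1 E3.
  exists (r i), v, A, B; split=> //; split=> //.
    by exists k1; rewrite E1; ring.
  by exists k3; rewrite E3; ring.
exists v, (r i), B, A; split; [split=> // | exact: maxnC | by rewrite addnC].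
- by rewrite addnC.
- by exists k3; rewrite E3; ring.
- by exists k1; rewrite E1; ring.
Qed.

(** * The gaps as the union of the Euclidean sets *)

Lemma consecutive_leq s d : consecutive (in_semigroup p q) s d -> (d <= p)%N.
Proof.
have p0 : (0 < p)%N by rewrite ltnW ?(euclid_p eucl).
case=> Ss _ nS; rewrite leqNgt; apply/negP => lt_d.
apply: (negP (nS p _)); first by rewrite p0.
by apply: in_semigroup_shift; rewrite ?leq_addl ?addnK.
Qed.

Lemma mem_Gset_consecutive i l : (p <= q)%N -> (0 < i <= t)%N ->
  (r i <= l < r i.-1)%N ->
  l \in Gset r Z t i <-> exists s, consecutive (in_semigroup p q) s l.+1.
Proof.
move=> le_pq le_i /andP[le_l lt_l]; split.
  move=> /(mem_Gset _ le_i)[z lt_z ->].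
  have [u [v [A [B [bas _ <-]]]]] := euclid_lattice le_i lt_z.
  exact: lattice_basis_consecutive bas.
case=> s cons_s; apply/(mem_Gset _ le_i).
have r_gt0 : (0 < r i)%N by apply: euclid_gt0; lia.
(* The quotient is the [z] with [r_(i-1) - (z+1) r_i < l + 1 <= r_(i-1) - z r_i], which places
   [l + 1] in the interval of one basis. *)
have := divn_eq (r i.-1 - l.+1) (r i); have := ltn_pmod (r i.-1 - l.+1) r_gt0.
move: (_ %/ _)%N (_ %% _)%N => z m lt_m Em.
have lt_z : (r i + z * r i < r i.-1)%N by lia.
exists z => //.
have [u [v [A [B [bas max_uv uvE]]]]] := euclid_lattice le_i lt_z.
rewrite -uvE; apply: lattice_basis_distance bas _ cons_s => //.
rewrite max_uv uvE gtn_max mulSn; lia.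
Qed.

Lemma euclid_locate l : (0 < l < p)%N ->
  exists2 i, (0 < i <= t)%N & (r i <= l < r i.-1)%N.
Proof.
move=> /andP[l0 lt_l].
have ex_i : exists i, (r i <= l)%N by exists t; rewrite (euclid_rt eucl).
case: (ex_minnP ex_i) => i le_il min_i; exists i.
  rewrite min_i ?(euclid_rt eucl) // andbT lt0n; apply/eqP => i0.
  by move: le_il; rewrite i0 (euclid_r0 eucl) leqNgt lt_l.
rewrite le_il ltnNge; apply/negP => /min_i.
case: i le_il {min_i} => [|i]; last by rewrite ltnn.
by rewrite (euclid_r0 eucl) leqNgt lt_l.
Qed.

Lemma gapset_euclid : (p <= q)%N -> coprime p q ->
  gapset (semigroup_poly p q) = (\bigcup_(i <- iota 1 t) Gset r Z t i)%fset.
Proof.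
move=> le_pq cpq; have p1 := euclid_p eucl.
apply/fsetP => l; apply/idP/bigfcupP => [|[i]].
  case/(gapset_semigroup _ p1 (leq_trans p1 le_pq) cpq) => l0 cons_l.
  have lt_l : (l < p)%N by case: cons_l => s /consecutive_leq.
  have [|i le_i le_l] := @euclid_locate l; first by rewrite l0.
  exists i; first by rewrite mem_iota andbT add1n ltnS.
  exact/mem_Gset_consecutive.
rewrite mem_iota add1n ltnS andbT => le_i Gl; have le_l := Gset_bounds le_i Gl.
apply/(gapset_semigroup _ p1 (leq_trans p1 le_pq) cpq); split.
  by have r0 : (0 < r i)%N; [apply: euclid_gt0|]; lia.
exact/(mem_Gset_consecutive le_pq le_i le_l).
Qed.

Lemma card_bigcup_Gset n : (n <= t)%N ->
  #|` \bigcup_(i <- iota 1 n) Gset r Z t i|%fset =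
    (\sum_(1 <= i < n.+1) Gsize Z t i)%N.
Proof.
elim: n => [|n IHn] lt_n; first by rewrite big_nil cardfs0 big_geq.
have -> : iota 1 n.+1 = iota 1 n ++ [:: n.+1] by rewrite -(addn1 n) iotaD addnC.
rewrite big_cat big_seq1 big_nat_recr //= -IHn ?(ltnW lt_n) //.
rewrite cardfsU card_Gset ?lt_n //.
(* The sets lie in the disjoint intervals from [r_i] to [r_(i-1) - 1]. *)
suff -> : (\bigcup_(i <- iota 1 n) Gset r Z t i `&` Gset r Z t n.+1 = fset0)%fset.
  by rewrite cardfs0 subn0.
apply/fsetP => l; rewrite in_fsetI in_fset0; apply/negP => /andP[].
case/bigfcupP => i; rewrite mem_iota add1n ltnS andbT => le_i Gi Gn.
have := Gset_bounds (i := n.+1) _ Gn; have := Gset_bounds (i := i) _ Gi.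
have := @euclid_antitone i n; rewrite /=; lia.
Qed.

Lemma sum_Gsize : (\sum_(1 <= i < t.+1) Gsize Z t i)%N =
  ((\sum_(1 <= i < t.+1) r i.-1 %/ r i) - 1)%N.
Proof.
have t0 := euclid_t; rewrite !big_nat_recr //= /Gsize eqxx.
have [_ ZtE] := euclid_end; rewrite (euclid_rt eucl) divn1 -ZtE.
(* Hence the predecessor in the last summand does not truncate and accounts for the [- 1]. *)
have Zt_gt0 : (0 < Z t)%N.
  by rewrite ZtE (leq_ltn_trans _ (euclid_lt (i := t) _)) ?t0 /=.
rewrite -addnBA // subn1; congr (_ + _)%N; apply: eq_big_nat => i /andP[i0 lt_i].
rewrite ltn_eqF //; have [|-> lt_r] := euclid_div eucl (i := i).
  by rewrite i0 ltnW.
by rewrite divnMDl ?(leq_ltn_trans _ lt_r) // divn_small // addn0.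
Qed.

End Euclid.

Theorem theorem2 (p q : nat) (hp : (3 <= p)%N) (hpq : (p <= q)%N)
  (hcop : coprime p q) (t : nat) (r Z : nat -> nat)
  (hr0 : r 0%N = p) (hr1 : r 1%N = (q %% p)%N)
  (hdiv : forall i : nat, (1 <= i <= t)%N ->
     r i.-1 = (Z i * r i + r i.+1)%N /\ (r i.+1 < r i)%N)
  (ht : r t = 1%N) :
  [/\ Qpoly p q * Qden p q = Qnum p q
      /\ size (Qpoly p q) = ((p - 1) * (q - 1)).+1,
      r t.+1 = 0%N /\ Z t = r t.-1,
      Gset r Z t t = [fset x in iota 1 (r t.-1 - 1)]%fset,
      gapset (Qpoly p q) = (\bigcup_(i <- iota 1 t) Gset r Z t i)%fset
    & #|` gapset (Qpoly p q)|%fset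
        = ((\sum_(1 <= i < t.+1) r i.-1 %/ r i) - 1)%N ].
Proof.
have p1 : (1 < p)%N by apply: ltnW.
have q1 : (1 < q)%N by apply: leq_trans hpq.
have eucl : euclid p q t r Z by [].
have [QE fracE] := QpolyE (ltnW p1) (ltnW q1) hcop.
have gapE := gapset_euclid eucl hpq hcop; rewrite -QE in gapE.
have le_t : (0 < t <= t)%N by rewrite (euclid_t eucl) /=.
split=> //.
- by split=> //; rewrite QE size_semigroup_poly.
- exact: euclid_end eucl.
- apply/fsetP => l; rewrite !inE /= mem_iota.
  apply/(mem_Gset eucl _ le_t)/idP; rewrite ht.
    by case=> z; lia.
  by move=> le_l; exists (r t.-1 - l.+1)%N; lia.
- by rewrite gapE (card_bigcup_Gset eucl) // (sum_Gsize eucl).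
Qed.
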